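(* Let $G$ be a directed non-atomistic Abelian po-group. Then the following statements are equivalent: (i) the right wreath product $\mathbb Z\,\overrightarrow{\mathrm{wr}}\,G$ satisfies RDP; (ii) the left wreath product $\mathbb Z\,\overleftarrow{\mathrm{wr}}\,G$ satisfies RDP; (iii) $G$ satisfies RDP.
   Context: A po-group is a group $G$ (not necessarily Abelian; written here multiplicatively with neutral element $e$) endowed with a partial order $\le$ such that $a\le b$ implies $xay\le xby$ for all $x,y\in G$. Its positive cone is $G^+=\{g\in G: g\ge e\}$. It is directed if for all $g_1,g_2\in G$ there is $g\in G$ with $g_1,g_2\le g$. It is non-atomistic if for every $g\in G$ with $g>e$ there is $g'\in G$ with $g>g'>e$. Right and left wreath products: for a po-group $G$, let $W$ be the set of all pairs $(n,\langle g_i: i\in\mathbb Z\rangle)$ with $n\in\mathbb Z$, $g_i\in G$, and $g_i=e$ for all but finitely many $i\in\mathbb Z$, with the group operation $$(n,\langle g_i\rangle)*(m,\langle h_i\rangle)=(n+m,\langle g_i h_{i+n}: i\in\mathbb Z\rangle).$$ The right wreath product $\mathbb Z\,\overrightarrow{\mathrm{wr}}\,G$ is the group $W$ ordered by: $(n,\langle x_i\rangle)\le(m,\langle y_i\rangle)$ iff the two elements are equal, or $n<m$, or $n=m$ and $x_{i_0}<y_{i_0}$ where $i_0=\max\{i\in\mathbb Z: x_i\ne y_i\}$. The left wreath product $\mathbb Z\,\overleftarrow{\mathrm{wr}}\,G$ is the group $W$ ordered in the same way but with $i_0=\min\{i\in\mathbb Z: x_i\ne y_i\}$. Both are po-groups.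 A po-group $G$ satisfies RDP if for all $a_1,a_2,b_1,b_2\in G^+$ with $a_1a_2=b_1b_2$ there are $c_{11},c_{12},c_{21},c_{22}\in G^+$ such that $a_1=c_{11}c_{12}$, $a_2=c_{21}c_{22}$, $b_1=c_{11}c_{21}$, $b_2=c_{12}c_{22}$. *)

(* Defs.v *)
From HB Require Import structures.
From mathcomp Require Import all_boot all_order all_algebra finmap.
From mathcomp Require Import boolp.

Set Implicit Arguments.
Unset Strict Implicit.
Unset Printing Implicit Defensive.

Import Order.TTheory GRing.Theory Num.Theory.

HB.mixin Record Group_POrder_isPoGroup (d : Order.disp_t) G
    of Group G & Order.POrder d G := {
  lemg : forall a b x y : G, (a <= b)%O -> (x * a * y <= x * b * y)%O%g
}.

#[short(type="poGroupType")]
HB.structure Definition PoGroup (d : Order.disp_t) :=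
  {G of Group G & Order.POrder d G & Group_POrder_isPoGroup d G}.

Definition abelian_group (G : groupType) : Prop :=
  forall x y : G, (x * y = y * x)%g.

Section PoGroupProperties.
Local Open Scope group_scope.
Local Open Scope order_scope.
Context {d : Order.disp_t} (G : poGroupType d).

Definition directed : Prop :=
  forall g1 g2 : G, exists g : G, g1 <= g /\ g2 <= g.

Definition non_atomistic : Prop :=
  forall g : G, 1%g < g -> exists g' : G, 1%g < g' /\ g' < g.

Definition positive_cone (g : G) : Prop := 1%g <= g.

Definition RDP : Prop :=
  forall a1 a2 b1 b2 : G,
    positive_cone a1 -> positive_cone a2 ->
    positive_cone b1 -> positive_cone b2 ->
    a1 * a2 = b1 * b2 ->
    exists c11 c12 c21 c22 : G,
      (positive_cone c11 /\ positive_cone c12 /\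
       positive_cone c21 /\ positive_cone c22) /\
      (a1 = c11 * c12 /\ a2 = c21 * c22 /\
       b1 = c11 * c21 /\ b2 = c12 * c22).

End PoGroupProperties.

Section WreathGroup.
Local Open Scope fset_scope.
Local Open Scope ring_scope.
Variable G : groupType.

Definition wreath : Type := (int * {fsfun int -> G with 1%g})%type.

HB.instance Definition _ := Choice.on wreath.

Implicit Types u v w : wreath.

Lemma wreathP u v : u.1 = v.1 -> (forall i, u.2 i = v.2 i) -> u = v.
Proof. by case: u v => [n g] [m h] /= -> gh; congr pair; apply/fsfunP. Qed.

Definition wreath_one : wreath := (0, [fsfun]).

(* The finite sets below only bound the supports: see wreath_mulE and
   wreath_invE for the coordinates at an arbitrary index. *)
Definition wreath_mul u v : wreath :=
  (u.1 + v.1,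
   [fsfun i in finsupp u.2 `|` [fset j - u.1 | j in finsupp v.2]
      => (u.2 i * v.2 (i + u.1))%g]).

Definition wreath_inv u : wreath :=
  (- u.1, [fsfun i in [fset j + u.1 | j in finsupp u.2]
             => (u.2 (i - u.1))^-1%g]).

Lemma wreath_mulE u v i :
  (wreath_mul u v).2 i = (u.2 i * v.2 (i + u.1))%g.
Proof.
rewrite /wreath_mul /= fsfunE; case: ifPn => //.
rewrite in_fsetU negb_or => /andP[iu iv].
rewrite (fsfun_dflt iu) fsfun_dflt ?mulg1 //.
apply: contra iv => iv; apply/imfsetP; exists (i + u.1) => //.
by rewrite addrK.
Qed.

Lemma wreath_invE u i : (wreath_inv u).2 i = (u.2 (i - u.1))^-1%g.
Proof.
rewrite /wreath_inv /= fsfunE; case: ifPn => // iu.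
rewrite fsfun_dflt ?invg1 //.
apply: contra iu => iu; apply/imfsetP; exists (i - u.1) => //.
by rewrite subrK.
Qed.

Lemma wreath_oneE i : wreath_one.2 i = 1%g.
Proof. by rewrite fsfun0E. Qed.

Fact wreath_mulA : associative wreath_mul.
Proof.
move=> u v w; apply: wreathP => [|i]; first by rewrite /= addrA.
by rewrite !wreath_mulE /= mulgA addrA.
Qed.

Fact wreath_mul1 : left_id wreath_one wreath_mul.
Proof.
move=> u; apply: wreathP => [|i]; first by rewrite /= add0r.
by rewrite wreath_mulE wreath_oneE mul1g addr0.
Qed.

Fact wreath_1mul : right_id wreath_one wreath_mul.
Proof.
move=> u; apply: wreathP => [|i]; first by rewrite /= addr0.
by rewrite wreath_mulE wreath_oneE mulg1.
Qed.

Fact wreath_mulV : left_inverse wreath_one wreath_inv wreath_mul.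
Proof.
move=> u; apply: wreathP => [|i]; first by rewrite /= addNr.
by rewrite wreath_mulE wreath_invE wreath_oneE /= mulVg.
Qed.

Fact wreath_Vmul : right_inverse wreath_one wreath_inv wreath_mul.
Proof.
move=> u; apply: wreathP => [|i]; first by rewrite /= addrN.
by rewrite wreath_mulE wreath_invE wreath_oneE /= addrK mulgV.
Qed.

HB.instance Definition _ := isGroup.Build wreath
  wreath_mulA wreath_mul1 wreath_1mul wreath_mulV wreath_Vmul.

End WreathGroup.

Section WreathOrder.
Local Open Scope ring_scope.
Context {d : Order.disp_t} (G : poGroupType d).
Implicit Types u v w : wreath G.

(* [r i j] reads as [i] before [j]; [i0] is the last index, for [r], at which
   [u] and [v] differ: the maximum for [<=%R], the minimum for [>=%R]. *)
Definition last_diff (r : rel int) u v (i0 : int) : Prop :=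
  u.2 i0 <> v.2 i0 /\ forall i, u.2 i <> v.2 i -> r i i0.

Definition wreath_lt (r : rel int) u v : Prop :=
  u.1 < v.1 \/
  u.1 = v.1 /\ exists i0, last_diff r u v i0 /\ (u.2 i0 < v.2 i0)%O.

Definition wreath_le (r : rel int) u v : bool := `[< u = v \/ wreath_lt r u v >].

Section Theory.
Variable r : rel int.
Hypotheses (r_refl : reflexive r) (r_anti : antisymmetric r)
  (r_trans : transitive r) (r_total : total r)
  (r_shift : forall k i j, r (i + k) (j + k) = r i j).

Lemma wreath_lt_asym u v : wreath_lt r u v -> ~ wreath_lt r v u.
Proof.
case=> [uv|[uv [i [[ni mi] lti]]]].
  case=> [vu|[vu _]]; first by have := lt_trans uv vu; rewrite ltxx.
  by rewrite vu ltxx in uv.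
case=> [vu|[_ [j [[nj mj] ltj]]]]; first by rewrite uv ltxx in vu.
have ij : i = j.
  by apply: r_anti; rewrite mj ?mi //; apply/nesym.
by have := lt_trans lti (eq_rect _ (fun k => (v.2 k < u.2 k)%O) ltj _ (esym ij)); rewrite ltxx.
Qed.

Lemma wreath_lt_trans v u w :
  wreath_lt r u v -> wreath_lt r v w -> wreath_lt r u w.
Proof.
case=> [uv|[uv [i [[ni mi] lti]]]] [vw|[vw [j [[nj mj] ltj]]]].
- by left; apply: lt_trans vw.
- by left; rewrite -vw.
- by left; rewrite uv.
right; split; first by rewrite uv.
have bnd k : u.2 k <> w.2 k -> r k i \/ r k j.
  move=> nk; have [e|/eqP/mi] := eqVneq (u.2 k) (v.2 k); last by left.
  by right; apply: mj; rewrite -e.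
have [eij|nij] := eqVneq i j.
  subst j; exists i; have lt := lt_trans lti ltj; split=> //; split.
    by move=> e; rewrite e ltxx in lt.
  by move=> k /bnd[].
have nr k l : k != l -> r k l -> ~ r l k.
  by move=> /eqP kl rkl rlk; apply: kl; apply: r_anti; rewrite rkl.
have [rij|rji] := orP (r_total i j).
  have e : u.2 j = v.2 j.
    apply/eqP; apply: contraT => /eqP/mi.
    by move/(nr _ _ nij): rij.
  exists j; rewrite /last_diff e; split=> //; split=> // k /bnd[] // rki.
  exact: r_trans rij.
have e : v.2 i = w.2 i.
  apply/eqP; apply: contraT => /eqP/mj.
  by rewrite eq_sym in nij; move/(nr _ _ nij): rji.
exists i; rewrite /last_diff -e; split=> //; split=> // k /bnd[] // rkj.
exact: r_trans rji.
Qed.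

Lemma wreath_le_refl : reflexive (wreath_le r).
Proof. by move=> u; apply/asboolP; left. Qed.

Lemma wreath_le_anti : antisymmetric (wreath_le r).
Proof.
move=> u v /andP[/asboolP[//|uv] /asboolP[//|vu]].
by case: (wreath_lt_asym uv vu).
Qed.

Lemma wreath_le_trans : transitive (wreath_le r).
Proof.
move=> v u w /asboolP[->//|uv] /asboolP[<-|vw]; apply/asboolP; right=> //.
exact: wreath_lt_trans vw.
Qed.

Lemma ltmg (a b x y : G) : (a < b)%O -> (x * a * y < x * b * y)%O%g.
Proof.
rewrite !lt_neqAle => /andP[nab /lemg->]; rewrite andbT.
by apply: contra nab => /eqP/mulIg/mulgI->.
Qed.

Lemma wreath_lemg u v x y :
  wreath_le r u v -> wreath_le r (x * u * y)%g (x * v * y)%g.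
Proof.
move=> /asboolP[->|uv]; apply/asboolP; [by left | right].
case: uv => [uv|[uv [i [[ni mi] lti]]]].
  by left; rewrite /= ltrD2r ltrD2l.
right; split; first by rewrite /= uv.
pose z k := y.2 (k + (x.1 + v.1)).
have Eu k : (x * u * y)%g.2 k = (x.2 k * u.2 (k + x.1) * z k)%g.
  by rewrite /z -uv !wreath_mulE.
have Ev k : (x * v * y)%g.2 k = (x.2 k * v.2 (k + x.1) * z k)%g.
  by rewrite /z !wreath_mulE.
exists (i - x.1); split; last by rewrite Eu Ev subrK; apply: ltmg.
split; first by rewrite Eu Ev subrK => /mulIg/mulgI.
move=> k; rewrite Eu Ev => nk; rewrite -(r_shift x.1) subrK.
by apply: mi => e; apply: nk; rewrite e.
Qed.

End Theory.
End WreathOrder.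

Section RightWreath.
Local Open Scope ring_scope.
Context {d : Order.disp_t} (G : poGroupType d).

Definition right_wreath : Type := wreath G.

HB.instance Definition _ := Group.on right_wreath.

Local Notation r := (<=%R : rel int).

Fact right_shift (k i j : int) : r (i + k) (j + k) = r i j.
Proof. exact: lerD2r. Qed.

HB.instance Definition _ := Order.Le_isPOrder.Build d right_wreath
  (@wreath_le_refl d G r)
  (@wreath_le_anti d G r (@le_anti _ int))
  (@wreath_le_trans d G r (@le_anti _ int) (@le_trans _ int) (@le_total _ int)).

HB.instance Definition _ := Group_POrder_isPoGroup.Build d right_wreath
  (fun u v x y => @wreath_lemg d G r right_shift u v x y).

Lemma right_wreath_leP (u v : right_wreath) :
  (u <= v)%O <->
  u = v \/ u.1 < v.1 \/
  u.1 = v.1 /\ exists i0 : int,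
    (u.2 i0 <> v.2 i0 /\ forall i, u.2 i <> v.2 i -> i <= i0) /\
    (u.2 i0 < v.2 i0)%O.
Proof. by split=> [/asboolP|uv] //; apply/asboolP. Qed.

End RightWreath.

Section LeftWreath.
Local Open Scope ring_scope.
Context {d : Order.disp_t} (G : poGroupType d).

Definition left_wreath : Type := wreath G.

HB.instance Definition _ := Group.on left_wreath.

Local Notation r := (>=%R : rel int).

Fact left_shift (k i j : int) : r (i + k) (j + k) = r i j.
Proof. exact: lerD2r. Qed.

HB.instance Definition _ := Order.Le_isPOrder.Build d left_wreath
  (@wreath_le_refl d G r)
  (@wreath_le_anti d G r (@ge_anti _ int))
  (@wreath_le_trans d G r (@ge_anti _ int) (@ge_trans _ int) (@ge_total _ int)).

HB.instance Definition _ := Group_POrder_isPoGroup.Build d left_wreath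
  (fun u v x y => @wreath_lemg d G r left_shift u v x y).

Lemma left_wreath_leP (u v : left_wreath) :
  (u <= v)%O <->
  u = v \/ u.1 < v.1 \/
  u.1 = v.1 /\ exists i0 : int,
    (u.2 i0 <> v.2 i0 /\ forall i, u.2 i <> v.2 i -> i0 <= i) /\
    (u.2 i0 < v.2 i0)%O.
Proof. by split=> [/asboolP|uv] //; apply/asboolP. Qed.

End LeftWreath.

(* Main.v *)
(* Both wreath products are lexicographic extensions of the base group, the
   finitely supported families of elements of G, by Z, and the base group is
   itself lexicographic along Z.  A 2x2 refinement table is determined by its
   corner c11.  When the leading parts of its entries can be taken nontrivial,
   the lower parts are free; when a single leading part vanishes, or two in a
   row or a column, one entry can be taken to be e; when exactly the two entries
   of a diagonal have trivial leading part, they are chosen as an upper bound U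
   of e and d, and as U d^-1, for a lower-order element d, which uses that G is
   directed.  The argument is uniform in the order [r] on indices, so it treats
   the right and the left product at once.  Conversely, a refinement of families
   concentrated at the index 0 restricts to a refinement of their coordinates at
   0. *)

Require Import Defs.
From mathcomp Require Import all_boot all_order.
From mathcomp Require Import all_algebra finmap boolp.

Set Implicit Arguments.
Unset Strict Implicit.
Unset Printing Implicit Defensive.

Import Order.TTheory GRing.Theory Num.Theory.

Local Open Scope order_scope.
Local Open Scope group_scope.

(** * Positive elements and strict upper bounds in a po-group *)

Section PoGroupFacts.
Context {d : Order.disp_t} (G : poGroupType d).
Implicit Types g h : G.

Lemma mulg_eq1_ge1 g h : 1 <= g -> 1 <= h -> g * h = 1 -> g = 1 /\ h = 1.
Proof.
move=> g1 h1 gh.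
have g_le1 : g <= 1 by have := lemg 1 h g 1 h1; rewrite !mulg1 gh.
have g_eq1 : g = 1 by apply/eqP; rewrite eq_le g_le1 g1.
by split=> //; rewrite -gh g_eq1 mul1g.
Qed.

(** An upper bound [h] of [1] and [g] becomes strict on squaring, as [h < h * h] when [1 < h]. If
    [h = 1], then [g < 1] and [g^-1] serves. *)
Lemma directed_gt g : directed G -> g != 1 -> exists h, 1 < h /\ g < h.
Proof.
move=> dirG g_neq1; have [h [h1 gh]] := dirG 1 g.
have [h_eq1|h_neq1] := eqVneq h 1.
  have g_lt1 : g < 1 by rewrite lt_neqAle g_neq1 -h_eq1.
  have Vg_gt1 : 1 < g^-1.
    by have := ltmg g^-1 1 g_lt1; rewrite !mulg1 mulVg.
  by exists g^-1; split=> //; apply: lt_trans Vg_gt1.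
have h_gt1 : 1 < h by rewrite lt_neqAle eq_sym h_neq1.
have lt_h_hh : h < h * h by have := ltmg h 1 h_gt1; rewrite !mulg1.
by exists (h * h); split; [apply: lt_trans lt_h_hh | apply: le_lt_trans lt_h_hh].
Qed.

End PoGroupFacts.

(** * Refinement tables in a group *)

Section Refinement.
Variables (W : groupType) (P : W -> Prop).

(** The cone is a parameter [P] because the right and the left product share one group and differ
    only in their positive elements. *)
Definition refinement (a1 a2 b1 b2 : W) : Prop :=
  exists c11 c12 c21 c22 : W,
    (P c11 /\ P c12 /\ P c21 /\ P c22) /\
    (a1 = c11 * c12 /\ a2 = c21 * c22 /\ b1 = c11 * c21 /\ b2 = c12 * c22).

(* The corner [x] determines the other three entries of the table; the last
   hypothesis says that they multiply up to [b2]. *)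
Lemma refinement_corner x a1 a2 b1 b2 :
  a1 * a2 = b1 * b2 ->
  P x -> P (x^-1 * a1) -> P (x^-1 * b1) -> P (b1^-1 * x * a2) ->
  x^-1 * a1 * (b1^-1 * x) = b1^-1 * a1 ->
  refinement a1 a2 b1 b2.
Proof.
move=> ab Px Pxa Pxb Pxc E; exists x, (x^-1 * a1), (x^-1 * b1), (b1^-1 * x * a2).
split=> //; rewrite !mulVKg; split=> //; split; first by rewrite !mulgA mulgK mulVg mul1g.
by split=> //; rewrite mulgA E -mulgA ab mulKg.
Qed.

End Refinement.

(** * Coordinates in the wreath product and its base group, the elements with integer component
    [0] *)

Section Wreath.
Context {d : Order.disp_t} (G : poGroupType d).
Implicit Types u v : wreath G.

Lemma wreath_mul1E u v : (u * v).1 = (u.1 + v.1)%R. Proof. by []. Qed.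
Lemma wreath_inv1E u : u^-1.1 = (- u.1)%R. Proof. by []. Qed.

Lemma wreath_mul2E u v i : (u * v).2 i = u.2 i * v.2 (i + u.1)%R.
Proof. exact: wreath_mulE. Qed.

Lemma wreath_inv2E u i : u^-1.2 i = (u.2 (i - u.1)%R)^-1.
Proof. exact: wreath_invE. Qed.

Lemma wreath_one2E i : (1 : wreath G).2 i = 1.
Proof. exact: wreath_oneE. Qed.

Lemma base_mul2E u v i : u.1 = 0%R -> (u * v).2 i = u.2 i * v.2 i.
Proof. by move=> u0; rewrite wreath_mul2E u0 addr0. Qed.

Lemma base_inv2E u i : u.1 = 0%R -> u^-1.2 i = (u.2 i)^-1.
Proof. by move=> u0; rewrite wreath_inv2E u0 subr0. Qed.

Lemma base_commute u v :
  abelian_group G -> u.1 = 0%R -> v.1 = 0%R -> u * v = v * u.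
Proof.
move=> abG u0 v0; apply: wreathP => [|i]; first by rewrite !wreath_mul1E addrC.
by rewrite !base_mul2E // abG.
Qed.

Definition wreath_single (k : int) (g : G) : wreath G :=
  (0%R, [fsfun i in [fset k]%fset => g]).

Lemma wreath_singleE k g i :
  (wreath_single k g).2 i = if i == k then g else 1.
Proof. by rewrite /= fsfunE in_fset1. Qed.

(** * Positivity and leading coordinates for an index order [r] *)

Section Order.
Variable r : rel int.
Hypotheses (r_refl : reflexive r) (r_anti : antisymmetric r)
  (r_trans : transitive r) (r_total : total r).

Definition wreath_pos u : Prop := wreath_le r 1 u.
Local Notation pos := wreath_pos.

Lemma wreath_pos1 : pos 1. Proof. by apply/asboolP; left. Qed.

Lemma wreath_pos_gt0 u : (0 < u.1)%R -> pos u.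
Proof. by move=> u0; apply/asboolP; right; left. Qed.

Lemma wreath_pos_ge0 u : pos u -> (0 <= u.1)%R.
Proof. by move=> /asboolP[<-//|[/ltW//|[<-]]]. Qed.

(* [j] is strictly after [i] for the total order [r] iff [~~ r j i]. *)
Definition trivial_after i u : Prop := forall j, ~~ r j i -> u.2 j = 1.

Lemma trivial_afterM i u v :
  u.1 = 0%R -> trivial_after i u -> trivial_after i v -> trivial_after i (u * v).
Proof. by move=> u0 tu tv j nj; rewrite base_mul2E // tu // tv // mulg1. Qed.

Lemma trivial_afterV i u :
  u.1 = 0%R -> trivial_after i u -> trivial_after i u^-1.
Proof. by move=> u0 tu j nj; rewrite base_inv2E // tu // invg1. Qed.

Lemma trivial_after_single i g : trivial_after i (wreath_single i g).
Proof.
by move=> j nj; rewrite wreath_singleE; case: eqP nj => // ->; rewrite r_refl.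
Qed.

Lemma wreath_posI i u : u.1 = 0%R -> trivial_after i u -> 1 < u.2 i -> pos u.
Proof.
move=> u0 ui gt1; apply/asboolP; right; right; split=> //.
exists i; rewrite /last_diff wreath_one2E; split=> //; split.
  by move=> e; rewrite -e ltxx in gt1.
move=> j; rewrite wreath_one2E => nj; apply: contraT => /ui e.
by case: nj.
Qed.

(** If [u.2 i] is not [1], then [i] is the last index where [u] differs from [1], so it is the index
    that decides positivity. *)
Lemma wreath_pos_coord i u :
  u.1 = 0%R -> trivial_after i u -> pos u -> 1 <= u.2 i.
Proof.
move=> u0 ui /asboolP[<-|[|[_ [k [[]]]]]].
- by rewrite wreath_one2E.
- by rewrite u0 ltxx.
rewrite wreath_one2E => nk mk gtk.
have [->//|ni] := eqVneq (u.2 i) 1.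
have rik : r i k by apply: mk; rewrite wreath_one2E; apply/eqP; rewrite eq_sym.
have rki : r k i by apply: contraT => /ui e; rewrite e in nk.
by rewrite (r_anti (_ : r i k && r k i)) ?rik ?ltW.
Qed.

Lemma seq_top (s : seq int) :
  s = [::] \/ exists2 i, i \in s & forall j, j \in s -> r j i.
Proof.
elim: s => [|k s IHs]; [by left | right].
case: IHs => [->|[i si mi]].
  by exists k; rewrite ?inE // => j; rewrite inE => /eqP->.
have [rki|rik] := orP (r_total k i).
  exists i; first by rewrite inE si orbT.
  by move=> j; rewrite inE => /predU1P[->|/mi].
exists k; first by rewrite inE eqxx.
move=> j; rewrite inE => /predU1P[->//|/mi rji]; exact: r_trans rik.
Qed.

(** The finite union of the supports, if nonempty, has an [r]-last element. It serves as a leading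
    index for all members at once. *)
Lemma common_top (us : seq (wreath G)) :
  (forall u, u \in us -> forall j, u.2 j = 1) \/
  exists i, (exists2 u, u \in us & u.2 i != 1) /\
    forall u, u \in us -> trivial_after i u.
Proof.
pose s := flatten [seq (finsupp u.2 : seq int) | u <- us].
have sP u j : u \in us -> u.2 j != 1 -> j \in s.
  move=> us_u uj; apply/flatten_mapP; exists u => //.
  by rewrite mem_finsupp.
have [s0|[i si mi]] := seq_top s; [left|right].
  move=> u us_u j; apply/eqP; apply: contraT => /(sP _ _ us_u).
  by rewrite s0.
exists i; split.
  by have /flatten_mapP[u us_u] := si; rewrite mem_finsupp; exists u.
move=> u us_u j nji; apply/eqP; apply: contraT => /(sP _ _ us_u)/mi.
by rewrite (negbTE nji).
Qed.

(** It suffices to dominate [u] strictly at its leading index, so a single nontrivial coordinate is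
    enough. The support condition keeps [v] trivial wherever [u] is, so that [v] cannot disturb
    higher coordinates. *)
Lemma base_upper_bound u : directed G -> u.1 = 0%R ->
  exists v, [/\ v.1 = 0%R, forall j, u.2 j = 1 -> v.2 j = 1,
                pos v & pos (v * u^-1)].
Proof.
move=> dirG u0.
have [u1|[k [[_ /[!inE]/eqP-> uk] topk]]] := common_top [:: u].
  exists 1; split=> [//|j _||]; [exact: wreath_one2E | exact: wreath_pos1 |].
  suff -> : u = 1 by rewrite mulgV; apply: wreath_pos1.
  by apply: wreathP => // j; rewrite u1 ?inE // wreath_one2E.
have {}topk : trivial_after k u by apply: topk; rewrite inE.
have [h [h_gt1 uh]] := directed_gt dirG uk.
exists (wreath_single k h); split=> //.
- by move=> j; rewrite wreath_singleE; case: eqP => [->/eqP|//]; rewrite (negbTE uk).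
- apply: (@wreath_posI k) => //; first exact: trivial_after_single.
  by rewrite wreath_singleE eqxx.
apply: (@wreath_posI k).
- by rewrite wreath_mul1E wreath_inv1E u0 subr0.
- move=> j nj; rewrite base_mul2E // base_inv2E // wreath_singleE topk //.
  by rewrite invg1 mulg1; case: eqP nj => // ->; rewrite r_refl.
- rewrite base_mul2E // base_inv2E // wreath_singleE eqxx.
  by have := ltmg 1 (u.2 k)^-1 uh; rewrite !mul1g mulgV.
Qed.

(** * Refinement in the base group *)

(** RDP of [G] refines the coordinates at the common leading index [i]. A table entry lifting a
    coordinate above [1] and trivial after [i] is positive, so only entries with coordinate [1] need
    care. *)
Lemma base_refinement (a1 a2 b1 b2 : wreath G) :
  directed G -> abelian_group G -> RDP G ->
  a1.1 = 0%R -> a2.1 = 0%R -> b1.1 = 0%R -> b2.1 = 0%R ->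
  pos a1 -> pos a2 -> pos b1 -> pos b2 ->
  a1 * a2 = b1 * b2 -> refinement pos a1 a2 b1 b2.
Proof.
move=> dirG abG rdpG a1_0 a2_0 b1_0 b2_0 Pa1 Pa2 Pb1 Pb2 ab.
have base0 := (wreath_mul1E, wreath_inv1E, a1_0, a2_0, b1_0, b2_0, addr0, oppr0).
have corner (x : wreath G) : x.1 = 0%R -> pos x -> pos (x^-1 * a1) -> pos (x^-1 * b1) ->
    pos (b1^-1 * x * a2) -> refinement pos a1 a2 b1 b2.
  move=> x0 Px Pxa Pxb Pxc; apply: (refinement_corner ab Px) => //.
  rewrite (base_commute (u := x^-1 * a1)) ?base0 ?x0 ?base0 //.
  by rewrite mulgA mulgK.
have [all1|[i [[w w_in wi] top]]] := common_top [:: a1; a2; b1; b2].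
  have one u : u \in [:: a1; a2; b1; b2] -> u.1 = 0%R -> u = 1.
    by move=> /all1 u1 u0; apply: wreathP => // j; rewrite u1 wreath_one2E.
  have [ea1 ea2 eb1] : [/\ a1 = 1, a2 = 1 & b1 = 1].
    by split; apply: one; rewrite ?inE ?eqxx ?orbT.
  by apply: (corner 1); rewrite // ?ea1 ?ea2 ?eb1 ?invg1 ?mulg1; apply: wreath_pos1.
have [ta1 ta2 tb1 tb2] : [/\ trivial_after i a1, trivial_after i a2,
    trivial_after i b1 & trivial_after i b2].
  by split; apply: top; rewrite !inE eqxx ?orbT.
have abi : a1.2 i * a2.2 i = b1.2 i * b2.2 i by rewrite -!base_mul2E // ab.
have [c11 [c12 [c21 [c22 [[p11 [p12 [p21 p22]]]]]]]] := rdpG _ _ _ _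
  (wreath_pos_coord a1_0 ta1 Pa1) (wreath_pos_coord a2_0 ta2 Pa2)
  (wreath_pos_coord b1_0 tb1 Pb1) (wreath_pos_coord b2_0 tb2 Pb2) abi.
move=> [ea1 [ea2 [eb1 eb2]]].
rewrite /positive_cone in p11 p12 p21 p22.
have gt1 (c : G) : 1 <= c -> c != 1 -> 1 < c by rewrite lt_neqAle eq_sym => -> ->.
have coordE := (base_mul2E, base_inv2E, ea1, ea2, eb1, eb2).
have Vb1a1 : b1^-1 * a1 = b2 * a2^-1.
  by apply: (mulIg a2); rewrite mulgVK -mulgA ab mulKg.
have Vb1a2 : b1^-1 * a2 = b2 * a1^-1.
  apply: (mulIg a1); rewrite mulgVK -mulgA.
  by rewrite (base_commute abG a2_0 a1_0) ab mulKg.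
(* In each of the next four cases, an entry with coordinate [1] at [i] is set to [1]. Its two
   neighbours are then given factors, and the opposite entry has a coordinate above [1]. *)
have case11 : c11 = 1 -> c22 != 1 -> refinement pos a1 a2 b1 b2.
  move=> e11 n22; apply: (corner 1); rewrite ?invg1 ?mul1g ?mulg1 //.
    exact: wreath_pos1.
  apply: (@wreath_posI i); rewrite ?base0 //.
    by do ![apply: trivial_afterM | apply: trivial_afterV]; rewrite ?base0.
  by rewrite !coordE ?base0 // e11 mul1g mulKg; apply: gt1.
have case12 : c12 = 1 -> c21 != 1 -> refinement pos a1 a2 b1 b2.
  move=> e12 n21; apply: (corner a1) => //; last by rewrite -mulgA ab mulKg.
    by rewrite mulVg; apply: wreath_pos1.
  apply: (@wreath_posI i); rewrite ?base0 //.
    by do ![apply: trivial_afterM | apply: trivial_afterV]; rewrite ?base0.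
  by rewrite !coordE ?base0 // e12 mulg1 mulKg; apply: gt1.
have case21 : c21 = 1 -> c12 != 1 -> refinement pos a1 a2 b1 b2.
  move=> e21 n12; apply: (corner b1) => //; last by rewrite mulVg mul1g.
    apply: (@wreath_posI i); rewrite ?base0 //.
      by do ![apply: trivial_afterM | apply: trivial_afterV]; rewrite ?base0.
    by rewrite !coordE ?base0 // e21 mulg1 mulKg; apply: gt1.
  by rewrite mulVg; apply: wreath_pos1.
have case22 : c22 = 1 -> c11 != 1 -> refinement pos a1 a2 b1 b2.
  move=> e22 n11; apply: (corner (a1 * b2^-1)); rewrite ?base0 //.
  - apply: (@wreath_posI i); rewrite ?base0 //.
      by do ![apply: trivial_afterM | apply: trivial_afterV]; rewrite ?base0.
    by rewrite !coordE ?base0 // e22 mulg1 mulgK; apply: gt1.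
  - by rewrite invgF mulgVK.
  - by rewrite invgF -Vb1a2 -mulgA (base_commute abG a2_0 b1_0) mulKg.
  - rewrite mulgA Vb1a1 -mulgA (base_commute (v := a2)) ?base0 //.
    by rewrite -mulgA mulKg mulgV; apply: wreath_pos1.
have [e12|n12] := eqVneq c12 1.
  have [e21|n21] := eqVneq c21 1; last exact: case12.
  have [e11|n11] := eqVneq c11 1.
    have [e22|n22] := eqVneq c22 1; last exact: case11.
    (* Four trivial coordinates would make all the factors trivial at [i], against the choice of
       [i]. *)
    case/negP: wi; move: w_in; rewrite !inE.
    by case/or4P=> /eqP->; rewrite ?ea1 ?ea2 ?eb1 ?eb2 ?e11 ?e12 ?e21 ?e22 mulg1.
  have [e22|n22] := eqVneq c22 1; first exact: case22.
  (* The corner [a1 * U^-1] makes the off-diagonal entries [U] and [U * (b1^-1 * a1)^-1]. As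
     [b1^-1 * a1] is trivial at [i] and after, so is [U], and the diagonal keeps the coordinates
     [c11] and [c22]. *)
  have [U [U0 Ud PU PUd]] := base_upper_bound (u := b1^-1 * a1) dirG
    ltac:(by rewrite !base0).
  have tU : trivial_after i U.
    by move=> j nj; apply: Ud; rewrite !coordE ?base0 // ta1 // tb1 // mulVg.
  have eU : U.2 i = 1.
    by apply: Ud; rewrite !coordE ?base0 // e12 e21 !mulg1 mulVg.
  have UE := (base0, U0).
  apply: (corner (a1 * U^-1)); rewrite ?UE //.
  - apply: (@wreath_posI i); rewrite ?UE //.
      by do ![apply: trivial_afterM | apply: trivial_afterV]; rewrite ?UE.
    by rewrite !coordE ?UE // eU e12 invg1 !mulg1; apply: gt1.
  - by rewrite invgF mulgVK.
  - by move: PUd; rewrite invgM invgK invgF mulgA.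
  - apply: (@wreath_posI i); rewrite ?UE //.
      by do ![apply: trivial_afterM | apply: trivial_afterV]; rewrite ?UE.
    by rewrite !coordE ?UE // eU e12 e21 invg1 !mulg1 mulVg !mul1g; apply: gt1.
have [e21|n21] := eqVneq c21 1; first exact: case21.
have [e11|n11] := eqVneq c11 1.
  have [e22|n22] := eqVneq c22 1; last exact: case11.
  (* Symmetrically, the diagonal entries become [U] and [U * (a1 * b2^-1)^-1], and [c12] and [c21]
     survive at [i]. *)
  have [U [U0 Ud PU PUd]] := base_upper_bound (u := a1 * b2^-1) dirG
    ltac:(by rewrite !base0).
  have tU : trivial_after i U.
    by move=> j nj; apply: Ud; rewrite !coordE ?base0 // ta1 // tb2 // mulgV.
  have eU : U.2 i = 1.
    by apply: Ud; rewrite !coordE ?base0 // e11 e22 mul1g mulg1 mulgV.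
  have UE := (base0, U0).
  apply: (corner U) => //.
  - apply: (@wreath_posI i); rewrite ?UE //.
      by do ![apply: trivial_afterM | apply: trivial_afterV]; rewrite ?UE.
    by rewrite !coordE ?UE // eU e11 invg1 !mul1g; apply: gt1.
  - apply: (@wreath_posI i); rewrite ?UE //.
      by do ![apply: trivial_afterM | apply: trivial_afterV]; rewrite ?UE.
    by rewrite !coordE ?UE // eU e11 invg1 !mul1g; apply: gt1.
  - rewrite (base_commute (v := U)) ?UE // -mulgA Vb1a2.
    by move: PUd; rewrite invgF.
have [e22|n22] := eqVneq c22 1; first exact: case22.
(* No coordinate at [i] is trivial, so any lift of [c11] that is trivial after [i] can be the
   corner. *)
have [x [x0 tx ex]] : exists x : wreath G,
    [/\ x.1 = 0%R, trivial_after i x & x.2 i = c11].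
  exists (wreath_single i c11); split=> //; first exact: trivial_after_single.
  by rewrite wreath_singleE eqxx.
have xE := (base0, x0).
apply: (corner x) => //; apply: (@wreath_posI i); rewrite ?xE //;
  try by do ![apply: trivial_afterM | apply: trivial_afterV]; rewrite ?xE.
- by rewrite ex; apply: gt1.
- by rewrite !coordE ?xE // ex mulKg; apply: gt1.
- by rewrite !coordE ?xE // ex mulKg; apply: gt1.
- by rewrite !coordE ?xE // ex invgM !mulgA !mulgVK mulVg mul1g; apply: gt1.
Qed.

(** * Refinement in the whole wreath product *)

(** An entry with positive integer component is positive whatever its coordinates. If [a1] and [b1]
    have different integer components, the one with the smaller component is the corner; otherwise
    the quotient [b1^-1 * a1] lies in the base group, where elements commute. *)
Lemma wreath_refinement (a1 a2 b1 b2 : wreath G) :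
  directed G -> abelian_group G -> RDP G ->
  pos a1 -> pos a2 -> pos b1 -> pos b2 ->
  a1 * a2 = b1 * b2 -> refinement pos a1 a2 b1 b2.
Proof.
move=> dirG abG rdpG Pa1 Pa2 Pb1 Pb2 ab.
have ab1 : (a1.1 + a2.1)%R = (b1.1 + b2.1)%R by rewrite -!wreath_mul1E ab.
have Vb1a1 : b1^-1 * a1 = b2 * a2^-1.
  by apply: (mulIg a2); rewrite mulgVK -mulgA ab mulKg.
have Va1b1 : a1^-1 * b1 = a2 * b2^-1.
  by apply: (mulIg b2); rewrite mulgVK -mulgA -ab mulKg.
have [lt1|lt1|e1] := ltgtP a1.1 b1.1.
- apply: (refinement_corner (x := a1) ab) => //; rewrite ?mulVg ?mul1g //.
  + exact: wreath_pos1.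
  + by apply: wreath_pos_gt0; rewrite wreath_mul1E wreath_inv1E addrC subr_gt0.
  + by rewrite -mulgA ab mulKg.
- apply: (refinement_corner (x := b1) ab) => //; rewrite ?mulVg ?mul1g ?mulg1 //.
  + by apply: wreath_pos_gt0; rewrite wreath_mul1E wreath_inv1E addrC subr_gt0.
  + exact: wreath_pos1.
have e2 : a2.1 = b2.1 by apply: (addrI a1.1); rewrite ab1 e1.
have [a1_gt0|a1_lt0|a1_0] := ltgtP 0%R a1.1; last first.
- have [a2_gt0|a2_lt0|a2_0] := ltgtP 0%R a2.1; last first.
  + by apply: base_refinement; rewrite // -?e1 -?e2.
  + by have := wreath_pos_ge0 Pa2; rewrite leNgt a2_lt0.
  apply: (refinement_corner (x := 1) ab); rewrite ?invg1 ?mul1g ?mulg1 //.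
  + exact: wreath_pos1.
  + by apply: wreath_pos_gt0; rewrite wreath_mul1E wreath_inv1E -e1 -a1_0 oppr0 add0r.
  + by apply: base_commute; rewrite // wreath_inv1E -e1 -a1_0 oppr0.
- by have := wreath_pos_ge0 Pa1; rewrite leNgt a1_lt0.
have [a2_gt0|a2_lt0|a2_0] := ltgtP 0%R a2.1; last first.
- have b2_0 : b2.1 = 0%R by rewrite -e2.
  have Va2_0 : a2^-1.1 = 0%R by rewrite wreath_inv1E -a2_0 oppr0.
  have Vb2_0 : b2^-1.1 = 0%R by rewrite wreath_inv1E b2_0 oppr0.
  (* This corner gives [c12 = b2], [c21 = a2] and [c22 = 1]. *)
  apply: (refinement_corner (x := a1 * b2^-1) ab).
  + by apply: wreath_pos_gt0; rewrite wreath_mul1E Vb2_0 addr0.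
  + by rewrite invgF mulgVK.
  + by rewrite invgF -mulgA Va1b1 (base_commute (u := a2)) // mulVKg.
  + rewrite mulgA Vb1a1 -2!mulgA (base_commute (v := a2)) //.
    by rewrite mulKg mulgV; apply: wreath_pos1.
  + rewrite invgF mulgVK (mulgA b1^-1) Vb1a1 -mulgA (base_commute (v := b2^-1)) //.
    by rewrite mulVKg.
- by have := wreath_pos_ge0 Pa2; rewrite leNgt a2_lt0.
have d0 : (b1^-1 * a1).1 = 0%R by rewrite wreath_mul1E wreath_inv1E e1 addNr.
(* The diagonal entries carry the positive integer components of [a1] and [a2]; the off-diagonal
   ones, [U] and [U * (b1^-1 * a1)^-1], lie in the base group. *)
have [U [U0 _ PU PUd]] := base_upper_bound dirG d0.
apply: (refinement_corner (x := a1 * U^-1) ab).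
- by apply: wreath_pos_gt0; rewrite wreath_mul1E wreath_inv1E U0 subr0.
- by rewrite invgF mulgVK.
- by move: PUd; rewrite invgM invgK invgF mulgA.
- by apply: wreath_pos_gt0; rewrite mulgA !wreath_mul1E !wreath_inv1E U0 e1 addNr subr0 add0r.
- rewrite invgF mulgVK (mulgA b1^-1) (base_commute (v := U^-1)) ?mulVKg //.
  by rewrite wreath_inv1E U0 oppr0.
Qed.

(** * Descent of refinements to [G] *)

(** At a common leading index other than [k], two coordinates at least [1] would have product [1],
    hence both be trivial. So the leading index is [k], where positivity passes to the
    coordinates. *)
Lemma wreath_pos_mul_single k (u v : wreath G) : u.1 = 0%R -> v.1 = 0%R ->
  pos u -> pos v -> (forall j, j != k -> (u * v).2 j = 1) ->
  1 <= u.2 k /\ 1 <= v.2 k.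
Proof.
move=> u0 v0 Pu Pv uvk; have [all1|[i [[w w_in wi] top]]] := common_top [:: u; v].
  by rewrite !all1 ?inE ?eqxx ?orbT.
have [tu tv] : trivial_after i u /\ trivial_after i v.
  by split; apply: top; rewrite !inE eqxx ?orbT.
have ui := wreath_pos_coord u0 tu Pu; have vi := wreath_pos_coord v0 tv Pv.
have [<-//|/uvk] := eqVneq i k; rewrite base_mul2E // => /(mulg_eq1_ge1 ui vi)[eu ev].
by case/negP: wi; move: w_in; rewrite !inE => /orP[]/eqP->; apply/eqP.
Qed.

Lemma wreath_refinement_RDP :
  (forall a1 a2 b1 b2 : wreath G, pos a1 -> pos a2 -> pos b1 -> pos b2 ->
     a1 * a2 = b1 * b2 -> refinement pos a1 a2 b1 b2) -> RDP G.
Proof.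
move=> refW a1 a2 b1 b2 pa1 pa2 pb1 pb2 ab.
pose s := wreath_single 0%R.
have pos_s g : 1 <= g -> pos (s g).
  move=> g_ge1; have [->|g_neq1] := eqVneq g 1.
    suff -> : s 1 = 1 by apply: wreath_pos1.
    by apply: wreathP => // i; rewrite wreath_singleE wreath_one2E if_same.
  apply: (@wreath_posI 0%R) => //; first exact: trivial_after_single.
  by rewrite wreath_singleE eqxx lt_neqAle eq_sym g_neq1.
have sM g h : s g * s h = s (g * h).
  apply: wreathP => // i.
  by rewrite base_mul2E // !wreath_singleE; case: eqP => // _; rewrite mulg1.
have [||||| c11 [c12 [c21 [c22 [[p11 [p12 [p21 p22]]]]]]]] :=
  refW (s a1) (s a2) (s b1) (s b2); try exact: pos_s.
  by rewrite !sM ab.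
(* The integer components of positive factors of [s g] are nonnegative with sum [0], so both factors
   lie in the base group. *)
have split0 (g : G) (u v : wreath G) : pos u -> pos v -> s g = u * v ->
    [/\ u.1 = 0%R, v.1 = 0%R, 1 <= u.2 0%R, 1 <= v.2 0%R & g = u.2 0%R * v.2 0%R].
  move=> Pu Pv suv; have uv0 : (u.1 + v.1)%R = 0%R by rewrite -wreath_mul1E -suv.
  have /andP[/eqP u0 /eqP v0] : (u.1 == 0%R) && (v.1 == 0%R).
    by rewrite -paddr_eq0 ?uv0 ?wreath_pos_ge0.
  have [|pu pv] := @wreath_pos_mul_single 0%R u v u0 v0 Pu Pv.
    by move=> j /negbTE nj; rewrite -suv wreath_singleE nj.
  by split=> //; rewrite -base_mul2E // -suv wreath_singleE eqxx.
move=> [/split0[]// _ _ q11 q12 ea1 [/split0[]// _ _ q21 q22 ea2]].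
move=> [/split0[]// _ _ _ _ eb1 /split0[]// _ _ _ _ eb2].
by exists (c11.2 0%R), (c12.2 0%R), (c21.2 0%R), (c22.2 0%R).
Qed.

End Order.
End Wreath.

(** * The equivalence for the two index orders *)

Theorem proposition5p5 (d : Order.disp_t) (G : poGroupType d) :
  directed G -> non_atomistic G -> abelian_group G ->
  [<-> RDP (right_wreath G); RDP (left_wreath G); RDP G].
Proof.
move=> dirG _ abG.
have le_tot : total (<=%R : rel int) := @le_total _ int.
have ge_tot : total (>=%R : rel int) by move=> x y; apply: le_tot.
tfae=> [rdp_right | rdp_left | rdpG].
(* The right product reaches the left one through [G]: descend with [<=%R], then lift with
   [>=%R]. *)
- have rdpG : RDP G := wreath_refinement_RDP
    (@le_refl _ int) (@le_anti _ int) (@le_trans _ int) le_tot rdp_right.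
  by move=> a1 a2 b1 b2; apply: (wreath_refinement
    (@ge_refl _ int) (@ge_anti _ int) (@ge_trans _ int) ge_tot).
- exact: (wreath_refinement_RDP
    (@ge_refl _ int) (@ge_anti _ int) (@ge_trans _ int) ge_tot rdp_left).
by move=> a1 a2 b1 b2; apply: (wreath_refinement
  (@le_refl _ int) (@le_anti _ int) (@le_trans _ int) le_tot).
Qed.
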